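(* The function $\operatorname{pack}$ is a packing bound function that satisfies the Euclidean bound.
   Context: A packing in a bounded set $C\subseteq\mathbb{R}^d$ is a subset $X$ of $C$ such that all distinct points of $X$ are at distance at least $2$ from each other; $\operatorname{pack}(C)$ is the largest possible size of a packing in $C$. Let $\mathcal{B}_d$ be the set of all bounded Borel subsets of $\mathbb{R}^d$ and $\mathcal{B} = \bigcup_d \mathcal{B}_d$. Write $d(x,y)=|x-y|$ for the Euclidean metric, $d(C,C') = \inf\{d(x,x') : x\in C, x'\in C'\}$ (equal to $\infty$ if $C$ or $C'$ is empty), and $C(\varepsilon) = \{x \in \mathbb{R}^d : d(x,C)<\varepsilon\}$ for $C \subseteq \mathbb{R}^d$. A function $\psi\colon C \to C'$ (possibly between subsets of Euclidean spaces of different dimensions) is distance-increasing if $d(\psi(x),\psi(y)) \ge d(x,y)$ for all $x,y\in C$. A packing bound function is a map $A\colon \mathcal{B}\to[0,\infty)$ such that for all $C,C'\in\mathcal{B}$ and $\varepsilon>0$: (1) (Sphere bound) if $C$ is nonempty and contained in the interior of a ball of radius $1$, then $A(C)=1$; (2) (Lipschitz inequality) if there exists a distance-increasing function $\psi\colon C\to C'$, then $A(C)\le A(C')$; (3) (Union axiom) if $C$ and $C'$ are subsets of the same ambient space $\mathbb{R}^d$ and $d(C,C')\ge 2$, then $A(C\cup C')=A(C)+A(C')$; (4) (Mesh axiom) if $C \subseteq C'(\varepsilon)$ (in the same ambient space), then $A(\frac{1}{1+\varepsilon}C)\le A(C')$. For a packing bound function $A$ and $n\ge1$, $\delta_{A,n}=\lim_{k\to\infty}A(2^kI^n)/2^{kn}$,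 where $I^n=[0,1]^n$; this limit always exists and is positive. $A$ satisfies the Euclidean bound if for every $n$, every bounded Borel subset $C\subseteq\mathbb{R}^n$ satisfies $A(C)\ge\delta_{A,n}\mathcal{L}_n(C)$, where $\mathcal{L}_n$ is Lebesgue measure. *)

(* Defs.v *)
From mathcomp Require Import all_boot all_order all_algebra.
From mathcomp Require Import all_classical all_reals all_analysis.
Set Implicit Arguments.
Unset Strict Implicit.
Unset Printing Implicit Defensive.
Import Order.TTheory GRing.Theory Num.Theory.
Import numFieldNormedType.Exports.
Local Open Scope classical_set_scope.
Local Open Scope ring_scope.

(* The normedModType structure of 'rV[R]_d carries the sup norm. It induces the
   usual topology and the usual bounded sets, so [open], [interior] and
   [bounded_set] are used directly; distances are the Euclidean ones below. *)

Definition enorm (R : realType) (d : nat) (x : 'rV[R]_d) : R :=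
  Num.sqrt (\sum_(i < d) x ord0 i ^+ 2).

Definition dist (R : realType) (d : nat) (x y : 'rV[R]_d) : R := enorm (x - y).

(* The infimum of the empty set is +oo, as wanted when C or C' is empty. *)
Definition dist_set (R : realType) (d : nat) (C C' : set 'rV[R]_d) : \bar R :=
  ereal_inf [set (dist x x')%:E | x in C & x' in C'].

Definition thickening (R : realType) (d : nat) (e : R) (C : set 'rV[R]_d) :
    set 'rV[R]_d :=
  [set x | (dist_set [set x] C < e%:E)%E].

Definition dilate (R : realType) (d : nat) (c : R) (C : set 'rV[R]_d) :
    set 'rV[R]_d :=
  [set c *: x | x in C].

Definition bounded_borel (R : realType) (d : nat) (C : set 'rV[R]_d) : Prop :=
  bounded_set C /\ <<s [set U : set 'rV[R]_d | open U] >> C.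

Definition dist_increasing (R : realType) (d d' : nat) (C : set 'rV[R]_d)
    (psi : 'rV[R]_d -> 'rV[R]_d') : Prop :=
  forall x y, C x -> C y -> dist x y <= dist (psi x) (psi y).

(* A map from bounded Borel sets (of all dimensions) to [0, +oo[ is represented
   by a function on all sets, with values in \bar R, on which constraints are
   only put at the bounded Borel sets; finiteness is the field [pbf_fin]. *)
Record packing_bound_function (R : realType)
    (A : forall d : nat, set 'rV[R]_d -> \bar R) : Prop := {
  pbf_ge0 : forall (d : nat) (C : set 'rV[R]_d),
    bounded_borel C -> (0 <= A d C)%E ;
  pbf_fin : forall (d : nat) (C : set 'rV[R]_d),
    bounded_borel C -> (A d C < +oo)%E ;
  pbf_sphere : forall (d : nat) (C : set 'rV[R]_d),
    bounded_borel C -> C !=set0 ->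
    (exists c : 'rV[R]_d, C `<=` interior [set x | dist c x <= 1]) ->
    A d C = 1%E ;
  pbf_lipschitz : forall (d d' : nat) (C : set 'rV[R]_d) (C' : set 'rV[R]_d'),
    bounded_borel C -> bounded_borel C' ->
    (exists psi : 'rV[R]_d -> 'rV[R]_d',
      set_fun C C' psi /\ dist_increasing C psi) ->
    (A d C <= A d' C')%E ;
  pbf_union : forall (d : nat) (C C' : set 'rV[R]_d),
    bounded_borel C -> bounded_borel C' ->
    (2%:E <= dist_set C C')%E ->
    A d (C `|` C') = (A d C + A d C')%E ;
  pbf_mesh : forall (d : nat) (C C' : set 'rV[R]_d) (e : R),
    bounded_borel C -> bounded_borel C' -> 0 < e ->
    C `<=` thickening e C' ->
    (A d (dilate (1 + e)^-1 C) <= A d C')%E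
}.

Definition packing (R : realType) (d : nat) (C X : set 'rV[R]_d) : Prop :=
  X `<=` C /\ (forall x y, X x -> X y -> x <> y -> 2 <= dist x y).

(* [counting X] is the cardinality of X, and +oo if X is infinite. *)
Definition pack (R : realType) (d : nat) (C : set 'rV[R]_d) : \bar R :=
  ereal_sup [set counting X | X in packing C].

Definition closed_box (R : realType) (n : nat) (a b : 'rV[R]_n) :
    set 'rV[R]_n :=
  [set x | forall i, a ord0 i <= x ord0 i <= b ord0 i].

(* Lebesgue (outer) measure on R^n, for n > 0: infimum of the total volumes of
   countable covers by closed boxes. (For n = 0 every box has volume 1, so the
   value is +oo; this case is never used.) *)
Definition lebesgue_rV (R : realType) (n : nat) (C : set 'rV[R]_n) : \bar R :=
  ereal_inf [set v | exists a b : nat -> 'rV[R]_n,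
    [/\ (forall k i, a k ord0 i <= b k ord0 i),
        C `<=` \bigcup_k closed_box (a k) (b k) &
        v = (\sum_(k <oo) (\prod_(i < n) (b k ord0 i - a k ord0 i))%:E)%E]].

Definition unit_cube (R : realType) (n : nat) : set 'rV[R]_n :=
  [set x | forall i, 0 <= x ord0 i <= 1].

Definition delta (R : realType) (A : forall d : nat, set 'rV[R]_d -> \bar R)
    (n : nat) : \bar R :=
  limn (fun k : nat =>
    (A n (dilate (2 ^+ k) (@unit_cube R n)) * ((2 ^+ (k * n))^-1)%:E)%E).

Definition euclidean_bound (R : realType)
    (A : forall d : nat, set 'rV[R]_d -> \bar R) : Prop :=
  forall n : nat, (0 < n)%N -> forall C : set 'rV[R]_n, bounded_borel C ->
    (delta A n * lebesgue_rV C <= A n C)%E.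

(* Main.v *)
(* The axioms hold because a map on the points of a packing that keeps them at
   distance at least 2 is injective. For the Euclidean bound, the
   sequence pack(2^k I^n) / 2^(kn) is nonincreasing, so delta is at most each of
   its terms. Cover C by the N cells of side h = (1 + e) / 2^j that it meets;
   then the Lebesgue measure of C is at most N h^n. Averaging an optimal packing
   X of 2^k I^n over grid translations of side 1 / 2^j and dilating by 1 + e, as
   in the mesh axiom, gives |X| N <= (2^(k + j) + O(1))^n pack(C), whence
   the bound by letting k, and then j, tend to infinity. *)
Require Import Defs.
From mathcomp Require Import all_boot all_order all_algebra.
From mathcomp Require Import all_classical all_reals all_analysis.
From mathcomp Require Import finmap zify ring lra.
Set Implicit Arguments.
Unset Strict Implicit.
Unset Printing Implicit Defensive.
Import Order.TTheory GRing.Theory Num.Theory.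
Import numFieldNormedType.Exports.
Local Open Scope classical_set_scope.
Local Open Scope ring_scope.

(** * Euclidean norm and distance on row vectors *)

Section EuclideanNorm.
Context {R : realType} {d : nat}.
Implicit Types (x y z : 'rV[R]_d) (c r : R).

Lemma enorm_ge0 x : 0 <= enorm x.
Proof. exact: sqrtr_ge0. Qed.

Lemma sqr_enorm x : enorm x ^+ 2 = \sum_(i < d) x ord0 i ^+ 2.
Proof. by rewrite sqr_sqrtr// sumr_ge0// => i _; rewrite sqr_ge0. Qed.

Lemma enorm0 : enorm (0 : 'rV[R]_d) = 0.
Proof. by rewrite /enorm big1 ?sqrtr0// => i _; rewrite mxE expr0n. Qed.

Lemma enormZ c x : enorm (c *: x) = `|c| * enorm x.
Proof.
rewrite /enorm -sqrtr_sqr -sqrtrM ?sqr_ge0// mulr_sumr.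
by congr Num.sqrt; apply: eq_bigr => i _; rewrite mxE exprMn.
Qed.

Lemma enormN x : enorm (- x) = enorm x.
Proof. by rewrite -scaleN1r enormZ normrN1 mul1r. Qed.

(* Lagrange's identity. *)
Lemma cauchy_schwarz x y :
  \sum_(i < d) x ord0 i * y ord0 i <= enorm x * enorm y.
Proof.
set P := \sum_(i < d) _.
apply: le_trans (ler_norm P) _.
rewrite -(@ler_pXn2r _ 2)// ?nnegrE ?mulr_ge0 ?enorm_ge0//.
rewrite real_normK ?num_real// exprMn !sqr_enorm.
set A := \sum_(i < d) x ord0 i ^+ 2; set B := \sum_(i < d) y ord0 i ^+ 2.
have : 0 <= \sum_(i < d) \sum_(j < d)
    (x ord0 i * y ord0 j - x ord0 j * y ord0 i) ^+ 2.
  by apply: sumr_ge0 => i _; apply: sumr_ge0 => j _; rewrite sqr_ge0.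
suff -> : \sum_(i < d) \sum_(j < d)
    (x ord0 i * y ord0 j - x ord0 j * y ord0 i) ^+ 2 =
    A * B + B * A - 2 * (P * P) by rewrite (expr2 P); lra.
rewrite /A /B /P !big_distrlr/= mulr_sumr -big_split/= -sumrB.
apply: eq_bigr => i _; rewrite mulr_sumr -big_split/= -sumrB.
by apply: eq_bigr => j _; ring.
Qed.

Lemma ler_enormD x y : enorm (x + y) <= enorm x + enorm y.
Proof.
rewrite -(@ler_pXn2r _ 2)// ?nnegrE ?addr_ge0 ?enorm_ge0//.
rewrite sqrrD !sqr_enorm.
under eq_bigr do rewrite mxE sqrrD.
rewrite !big_split/= lerD2r lerD2l -mulr2n lerMn2r/=.
exact: cauchy_schwarz.
Qed.

Lemma dist_ge0 x y : 0 <= dist x y.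
Proof. exact: enorm_ge0. Qed.

Lemma distxx x : dist x x = 0.
Proof. by rewrite /dist subrr enorm0. Qed.

Lemma distC x y : dist x y = dist y x.
Proof. by rewrite /dist -opprB enormN. Qed.

Lemma dist_triangle y x z : dist x z <= dist x y + dist y z.
Proof. by rewrite /dist -[x in x - z](subrK y) -addrA ler_enormD. Qed.

Lemma distZ c x y : 0 <= c -> dist (c *: x) (c *: y) = c * dist x y.
Proof. by move=> c0; rewrite /dist -scalerBr enormZ ger0_norm. Qed.

Lemma dist_addr z x y : dist (x + z) (y + z) = dist x y.
Proof. by rewrite /dist opprD addrACA subrr addr0. Qed.

(** The sharp constant is the square root of [d]; the cruder [d] is enough below and follows from
    [d <= d ^ 2]. *)
Lemma dist_le_coord x y r : 0 <= r ->
  (forall i, `|x ord0 i - y ord0 i| <= r) -> dist x y <= d%:R * r.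
Proof.
move=> r0 xyr; rewrite -(@ler_pXn2r _ 2)// ?nnegrE ?mulr_ge0 ?enorm_ge0//.
rewrite sqr_enorm; apply: (@le_trans _ _ (d%:R * r ^+ 2)).
  rewrite mulr_natl -[in leRHS](card_ord d) -sumr_const.
  apply: ler_sum => i _; rewrite !mxE -real_normK ?num_real//.
  by rewrite lerXn2r// nnegrE.
by rewrite exprMn ler_wpM2r ?sqr_ge0// -natrX ler_nat; case: (d) => // n; rewrite leq_pmulr.
Qed.

(** The norm behind [bounded_set] is the sup norm, a maximum over coordinates. *)
Lemma coord_boundedP (C : set 'rV[R]_d) : bounded_set C <->
  exists2 M : R, 0 <= M & forall x i, C x -> `|x ord0 i| <= M.
Proof.
split=> [|[M M0 CM]]; last first.
  exists M; split; first exact: num_real.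
  move=> y My x Cx; rewrite /Num.norm/= mx_normrE.
  apply/bigmax_leP; split=> [|[i j] _]/=; first exact: le_trans (ltW My).
  by rewrite ord1 (le_trans (CM _ _ Cx))// ltW.
move=> [M0 [_ /(_ (Num.max M0 0 + 1))]].
rewrite ltr_pwDr// ?le_max ?lexx// => /(_ isT) CM.
exists (Num.max M0 0 + 1); first by rewrite addr_ge0// le_max lexx orbT.
move=> x i /CM; apply: le_trans.
by rewrite /Num.norm/= mx_normrE (le_bigmax _ _ (ord0, i)).
Qed.

End EuclideanNorm.

(** * Numbering the cells of a cubical grid *)

Section Cells.
Context {R : realType} {d : nat}.
Implicit Types (x y : 'rV[R]_d).

(* The half-open cell of side [q^-1] containing [x], numbered from the corner
   [(-M, ..., -M)]. Junk value unless [0 <= q * (x i + M) < B.+1] for all [i]. *)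
Definition cell (q M : R) (B : nat) x : {ffun 'I_d -> 'I_B.+1} :=
  [ffun i => inord (Num.truncn (q * (x ord0 i + M)))].

Lemma cellP q M B x i : 0 <= q * (x ord0 i + M) < B.+1%:R ->
  (cell q M B x i)%:R <= q * (x ord0 i + M) < (cell q M B x i)%:R + 1.
Proof.
move=> /andP[h0 h1]; rewrite ffunE inordK; last by rewrite truncn_lt_nat.
by rewrite natr1; exact: truncn_itv.
Qed.

Lemma cell_scale q M x i : 0 <= q -> `|x ord0 i| <= M ->
  0 <= q * (x ord0 i + M) < (Num.truncn (q * (M + M))).+1%:R.
Proof.
move=> q0; rewrite ler_norml => /andP[Mx xM].
apply/andP; split; first by rewrite mulr_ge0//; lra.
by apply: le_lt_trans (truncnS_gt _); rewrite ler_wpM2l// lerD2r.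
Qed.

End Cells.

(** * Packing numbers and the axioms of a packing bound function *)

Section Pack.
Context {R : realType}.

Lemma size_partition (T : eqType) (V : finType) (F : T -> V) (t : seq T) :
  size t = (\sum_(v : V) size [seq x <- t | F x == v])%N.
Proof.
rewrite -sum1_size (partition_big F xpredT)//=.
by apply: eq_bigr => v _; rewrite size_filter sum1_count.
Qed.

Lemma counting_seq (T : choiceType) (s : seq T) : uniq s ->
  counting [set` s] = (size s)%:R%:E :> \bar R.
Proof.
move=> us; have -> : [set` s] = [set` [fset x in s]%fset].
  by apply/seteqP; split=> x /=; rewrite !inE.
rewrite /counting asboolT; last exact: finite_fset.
by rewrite set_fsetK card_fseq undup_id.
Qed.

Section Dim.
Context {d : nat}.
Implicit Types (C X : set 'rV[R]_d) (s : seq 'rV[R]_d).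

Lemma size_le_pack C s : uniq s -> packing C [set` s] ->
  ((size s)%:R%:E <= pack C)%E.
Proof.
by move=> us Cs; apply: ereal_sup_ubound; exists [set` s] => //; exact: counting_seq.
Qed.

(** Finite packings suffice: an infinite one contains finite packings of every size, which forces
    [e] to be [+oo]. *)
Lemma pack_le C (e : \bar R) :
  (forall s, uniq s -> packing C [set` s] -> ((size s)%:R%:E <= e)%E) ->
  (pack C <= e)%E.
Proof.
move=> H; apply: ge_ereal_sup => _ [X [XC Xsep]] <-.
have [fX|iX] := pselect (finite_set X).
  have sX : [set` (fset_set X : seq _)] = X by exact: fset_setK.
  have uX : uniq (fset_set X) by exact: fset_uniq.
  by rewrite -sX (counting_seq uX); apply: H => //; rewrite sX.
suff -> : e = +oo%E by rewrite leey.
apply: eq_infty => r.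
have [B BX szB] := infinite_set_fset (Num.truncn r).+1 iX.
apply: (@le_trans _ _ (size B)%:R%:E); last first.
  apply: H => //; first exact: fset_uniq.
  by split=> [x /BX/XC//|x y /BX Xx /BX Xy]; exact: Xsep.
rewrite lee_fin (le_trans (ltW (truncnS_gt r)))// ler_nat//.
Qed.

(** Separation makes [f] injective on [t], so no points are lost in the image. The Lipschitz and
    mesh axioms and both counting arguments for the Euclidean bound rest on this. *)
Lemma pack_size_le (T : eqType) (t : seq T) (f : T -> 'rV[R]_d) C :
  uniq t -> (forall x, x \in t -> C (f x)) ->
  (forall x y, x \in t -> y \in t -> x != y -> 2 <= dist (f x) (f y)) ->
  ((size t)%:R%:E <= pack C)%E.
Proof.
move=> ut Cf sep; rewrite -(size_map f); apply: size_le_pack.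
  rewrite map_inj_in_uniq// => x y xt yt fxy; apply/eqP/negP => /negP xy.
  by have := sep _ _ xt yt xy; rewrite fxy distxx; lra.
split=> [_ /= /mapP[x xt ->]|_ _ /= /mapP[x xt ->] /mapP[y yt ->] fxy].
  exact: Cf.
by apply: sep => //; apply: contra_notN fxy => /eqP ->.
Qed.

Lemma packing_bounded C : bounded_set C ->
  exists N : nat, forall s, uniq s -> packing C [set` s] -> (size s <= N)%N.
Proof.
move=> /coord_boundedP[M M0 CM].
(* Cells of side [1 / (d + 1)] have diameter at most [d / (d + 1) < 2], so [cell] is injective on a
   packing and the number of cells bounds its size. *)
pose q : R := d.+1%:R; have q0 : 0 < q by rewrite ltr0n.
pose B := Num.truncn (q * (M + M)).
exists #|{ffun 'I_d -> 'I_B.+1}| => s us [sC sep].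
rewrite -(size_map (cell q M B)) cardE; apply: uniq_leq_size; last first.
  by move=> v _; rewrite mem_enum.
rewrite map_inj_in_uniq// => x y xs ys xy; apply/eqP/negP => /negP xNy.
have : 2 <= dist x y by apply: sep => //; apply/eqP.
apply/negP; rewrite -ltNge.
apply: (@le_lt_trans _ _ (d%:R * q^-1)).
  apply: dist_le_coord => [|i]; first by rewrite invr_ge0 ltW.
  have /(cellP (B := B)) := cell_scale (ltW q0) (CM _ i (sC _ xs)).
  have /(cellP (B := B)) := cell_scale (ltW q0) (CM _ i (sC _ ys)).
  rewrite xy => ycell xcell.
  rewrite -[leRHS]mul1r ler_pdivlMr// -[X in _ * X <= _]gtr0_norm// -normrM.
  by rewrite ler_norml; apply/andP; split; lra.
by rewrite /q ltr_pdivrMr// -natrM ltr_nat; lia.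
Qed.

Lemma pack_attained C : bounded_set C ->
  exists s, [/\ uniq s, packing C [set` s] & pack C = (size s)%:R%:E].
Proof.
move=> /packing_bounded[N HN].
pose P n := `[< exists s, [/\ uniq s, packing C [set` s] & size s = n] >].
have exP : exists n, P n.
  by exists 0%N; apply/asboolP; exists [::]; split => //; split.
have ubP n : P n -> (n <= N)%N by move=> /asboolP[s [us Cs <-]]; exact: HN.
have [_ /asboolP[s [us Cs <-]] smax] := ex_maxnP exP ubP.
exists s; split => //; apply/le_anti/andP; split; last exact: size_le_pack.
apply: pack_le => t ut Ct; rewrite lee_fin ler_nat.
by apply: smax; apply/asboolP; exists t.
Qed.

Lemma pack_sphere C (c : 'rV[R]_d) : bounded_set C -> C !=set0 ->
  C `<=` interior [set x | dist c x <= 1] -> pack C = 1%E.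
Proof.
move=> bC [x Cx] Cc; apply/le_anti/andP; split; last first.
  apply: (@size_le_pack _ [:: x]) => //; split => [y|y z]/=.
    by rewrite inE => /eqP ->.
  by rewrite !inE => /eqP -> /eqP ->.
(* An interior point can be pushed slightly away from [c] without leaving the ball, so its distance
   to [c] is strictly below 1. Two points of [C] are then less than 2 apart. *)
have lt1 y : C y -> dist c y < 1.
  move=> /Cc; rewrite /interior/= => /nbhs_ballP[e/= e0 ey].
  have [le0|gt0] := leP (dist c y) 0; first exact: le_lt_trans le0 _.
  (* The displacement [t *: (y - c)] has sup norm below [e]; the [+ 1] keeps the denominator
     positive. *)
  pose t := e / 2 / (`|y - c| + 1).
  have nyc : 0 < `|y - c| + 1 by rewrite ltr_pwDr.
  have t0 : 0 < t by rewrite !divr_gt0.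
  have : dist c (y + t *: (y - c)) <= 1.
    apply: ey; rewrite -ball_normE/= opprD addNKr normrN normrZ gtr0_norm//.
    rewrite /t mulrAC ltr_pdivrMr//.
    apply: (@le_lt_trans _ _ (e / 2 * (`|y - c| + 1))).
      by rewrite ler_wpM2l ?lerDl//; lra.
    by rewrite ltr_pM2r//; lra.
  suff -> : dist c (y + t *: (y - c)) = (1 + t) * dist c y.
    by move: (dist c y) gt0 (t) t0 => r r0 t' t'0 h; nra.
  rewrite ![dist c _]distC /dist addrAC -{1}[y - c]scale1r -scalerDl enormZ.
  by rewrite ger0_norm// addr_ge0// ltW.
apply: pack_le => s us [sC sep]; rewrite lee_fin (ler_nat _ _ 1) leqNgt.
case: s us sC sep => [|y [|z s]]//= /andP[yzs _] sC sep.
have yNz : y <> z by move=> yz; rewrite yz inE eqxx in yzs.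
have /= := sep y z _ _ yNz; rewrite !inE !eqxx ?orbT => /(_ isT isT).
have := lt1 y (sC _ _); have := lt1 z (sC _ _); rewrite /= !inE !eqxx ?orbT.
move=> /(_ isT) ? /(_ isT) ?.
have := dist_triangle c y z; rewrite (distC y c); lra.
Qed.

Lemma pack_union C C' : bounded_set C -> bounded_set C' ->
  (2%:E <= dist_set C C')%E -> pack (C `|` C') = (pack C + pack C')%E.
Proof.
move=> bC bC' CC'.
have far x y : C x -> C' y -> 2 <= dist x y.
  move=> Cx C'y; rewrite -lee_fin; apply: le_trans CC' _.
  by apply: ereal_inf_lbound; exists x => //; exists y.
apply/le_anti/andP; split.
  apply: pack_le => s us [sC sep].
  rewrite -(count_predC (fun x => `[< C x >]) s) -!size_filter natrD EFinD.
  apply: leeD; apply: size_le_pack; rewrite ?filter_uniq//; split.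
  - by move=> x /=; rewrite mem_filter => /andP[/asboolP].
  - move=> x y /=; rewrite !mem_filter => /andP[_ xs] /andP[_ ys].
    exact: sep.
  - move=> x /=; rewrite mem_filter => /andP[/= /asboolPn Cx /sC].
    by case.
  - move=> x y /=; rewrite !mem_filter => /andP[_ xs] /andP[_ ys].
    exact: sep.
have [s [us [sC ssep] ->]] := pack_attained bC.
have [s' [us' [sC' ssep'] ->]] := pack_attained bC'.
rewrite -EFinD -natrD -size_cat; apply: size_le_pack.
  rewrite cat_uniq us us' andbT/=; apply/hasPn => x xs'; apply/negP => xs.
  by have := far _ _ (sC _ xs) (sC' _ xs'); rewrite distxx; lra.
split=> [x /=|x y /=]; rewrite !mem_cat.
  by move=> /orP[/sC|/sC']; [left|right].
move=> /orP[xs|xs] /orP[ys|ys] xy; [exact: ssep| | |exact: ssep'].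
- by apply: far; [exact: sC|exact: sC'].
- by rewrite distC; apply: far; [exact: sC|exact: sC'].
Qed.

Lemma pack_mesh C C' (e : R) : 0 < e -> C `<=` thickening e C' ->
  (pack (dilate (1 + e)^-1 C) <= pack C')%E.
Proof.
move=> e0 CC'; have e1 : 0 < 1 + e by rewrite addr_gt0.
apply: pack_le => s us [sC sep].
(* Dilating back by [1 + e] spreads the packing to separation [2 * (1 + e)]; moving each point by
   less than [e] into [C'] still leaves [2 * (1 + e) - 2 * e = 2]. *)
pose P (x y : 'rV[R]_d) := C' y /\ dist ((1 + e) *: x) y < e.
pose f x := xget 0 (P x).
have fP x : x \in s -> P x (f x).
  move=> /sC[y Cy <-]; apply: xgetPex; have := CC' _ Cy.
  rewrite /thickening/= => /ereal_inf_lt[_ [_ -> [z C'z <-]]].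
  by rewrite lte_fin => yz; exists z; split => //; rewrite scalerA divff ?gt_eqF// scale1r.
apply: (pack_size_le (f := f)) => // [x /fP[]//|x y xs ys /eqP xy].
have [_ fx] := fP _ xs; have [_ fy] := fP _ ys.
have := sep _ _ xs ys xy.
have := distZ x y (ltW e1).
have := dist_triangle (f x) ((1 + e) *: x) ((1 + e) *: y).
have := dist_triangle (f y) (f x) ((1 + e) *: y).
rewrite (distC (f y)); nra.
Qed.

End Dim.

Lemma pack_lipschitz d d' (C : set 'rV[R]_d) (C' : set 'rV[R]_d')
    (psi : 'rV[R]_d -> 'rV[R]_d') :
  set_fun C C' psi -> dist_increasing C psi -> (pack C <= pack C')%E.
Proof.
move=> CC' inc; apply: pack_le => s us [sC sep].
apply: (pack_size_le (f := psi)) => // [x /sC/CC'//|x y xs ys /eqP xy].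
by apply: le_trans (inc _ _ (sC _ xs) (sC _ ys)); exact: sep.
Qed.

Lemma packing_bound_function_pack : packing_bound_function (@pack R).
Proof.
split=> [d C [bC _]|d C [bC _]|d C [bC _] C0 [c]|d d' C C' _ _ [psi []]
  |d C C' [bC _] [bC' _]|d C C' e _ _].
- by have [s [_ _ ->]] := pack_attained bC.
- by have [s [_ _ ->]] := pack_attained bC; rewrite ltry.
- exact: pack_sphere.
- exact: pack_lipschitz.
- exact: pack_union.
- exact: pack_mesh.
Qed.

End Pack.

(** * Density of cubes and the Euclidean bound *)

Section EuclideanBound.
Context {R : realType}.
Implicit Types (n k j : nat).

Lemma dilate_unit_cubeP n (c : R) (x : 'rV[R]_n) : 0 < c ->
  dilate c (@unit_cube R n) x <-> forall i, 0 <= x ord0 i <= c.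
Proof.
move=> c0; split=> [[y yI <-] i|xc].
  have /andP[y0 y1] := yI i; rewrite !mxE mulr_ge0 ?(ltW c0)//=.
  by rewrite -[leRHS]mulr1 ler_wpM2l// ltW.
exists (c^-1 *: x); last by rewrite scalerA divff ?gt_eqF// scale1r.
move=> i; rewrite mxE mulrC; have /andP[x0 x1] := xc i.
by rewrite divr_ge0 ?(ltW c0)//= ler_pdivrMr// mul1r.
Qed.

Lemma bounded_dilate_unit_cube n (c : R) : 0 < c ->
  bounded_set (dilate c (@unit_cube R n)).
Proof.
move=> c0; apply/coord_boundedP; exists c; first exact: ltW.
move=> x i /(dilate_unit_cubeP _ c0) /(_ i) /andP[x0 xc].
by rewrite ger0_norm.
Qed.

(* Cutting at the midpoint of each side gives [2 ^ n] translates of the half-size cube. *)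
Lemma pack_dilate_double n (c : R) : 0 < c ->
  (pack (dilate (2 * c) (@unit_cube R n)) <=
   (2 ^+ n)%:E * pack (dilate c (@unit_cube R n)))%E.
Proof.
move=> c0; have c20 : 0 < 2 * c by rewrite mulr_gt0.
have [t [_ _ tE]] := pack_attained (@bounded_dilate_unit_cube n c c0).
apply: pack_le => s us [sC sep]; rewrite tE -EFinM lee_fin.
pose F (x : 'rV[R]_n) : {ffun 'I_n -> bool} := [ffun i => c < x ord0 i].
have fiber v : (size [seq x <- s | F x == v] <= size t)%N.
  (* This translation carries the part of the cube labelled [v] into the cube of side [c]. *)
  pose o : 'rV[R]_n := \row_i (if v i then - c else 0).
  rewrite -(ler_nat R) -lee_fin -tE.
  apply: (pack_size_le (f := fun x => x + o)); first exact: filter_uniq.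
    move=> x; rewrite mem_filter => /andP[/eqP Fx /sC].
    move=> /(dilate_unit_cubeP _ c20) xC; apply/dilate_unit_cubeP => // i.
    have := xC i; rewrite !mxE -Fx ffunE; case: ltP; lra.
  move=> x y; rewrite !mem_filter => /andP[_ xs] /andP[_ ys] /eqP xy.
  by rewrite dist_addr; exact: sep.
rewrite (size_partition F) -natrX -natrM ler_nat.
apply: (leq_trans (leq_sum _ (fun v _ => fiber v))).
by rewrite sum_nat_const card_ffun card_bool card_ord.
Qed.

(** By [pack_dilate_double] the sequence is nonincreasing, so its limit is its infimum. *)
Lemma delta_pack_le n k : (0 <= delta (@pack R) n <=
  pack (dilate (2 ^+ k) (@unit_cube R n)) * ((2 ^+ (k * n))^-1)%:E)%E.
Proof.
set u := fun k => (pack (dilate (2 ^+ k) (@unit_cube R n)) * ((2 ^+ (k * n))^-1)%:E)%E.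
have p2 l : 0 < 2 ^+ l :> R by rewrite exprn_gt0.
have u_noninc : {homo u : i j / (i <= j)%N >-> (j <= i)%E}.
  apply/nonincreasing_seqP => l; rewrite /u.
  rewrite mulSn exprD exprS invfM EFinM muleA; apply: lee_wpmul2r.
    by rewrite lee_fin invr_ge0 ltW.
  by rewrite lee_pdivrMr// muleC; exact: pack_dilate_double.
have := ereal_nonincreasing_cvgn u_noninc => /cvg_lim /= /(_ (@ereal_hausdorff R)).
rewrite -[X in X = _]/(delta (@pack R) n) => ->.
apply/andP; split; last by apply: ereal_inf_lbound; exists k.
apply: le_ereal_inf_tmp => _ [l _ <-]; rewrite /u.
have [t [_ _ ->]] := pack_attained (@bounded_dilate_unit_cube n _ (p2 l)).
by rewrite -EFinM lee_fin divr_ge0.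
Qed.

(** The factor before [m] tends to 1. This serves for both limits of the final argument, in [k] and
    in [j]. *)
Lemma le_of_le_expr_lim (a D m : R) n (J : nat) :
  (forall k, (J <= k)%N -> a <= (1 + D / 2 ^+ k) ^+ n * m) -> a <= m.
Proof.
move=> H.
have cv : (1 + D / 2 ^+ k) ^+ n * m @[k --> \oo] --> (1 + 0) ^+ n * m.
  apply: cvgM; last exact: cvg_cst.
  have : 1 + D / 2 ^+ k @[k --> \oo] --> (1 + 0 : R).
    apply: cvgD; first exact: cvg_cst.
    under eq_fun do rewrite -exprVn.
    by apply: cvg_geometric; rewrite ger0_norm ?invr_ge0// invf_lt1// ltr1n.
  move=> h; apply: (@continuous_cvg _ R R \oo _ _ (fun y => y ^+ n) _ _ h).
  exact: exprn_continuous.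
rewrite addr0 expr1n mul1r in cv.
by apply: (cvgr_to_ge cv); exists J.
Qed.

(** * Grid cells met by a bounded set *)

Section Grid.
Context {n : nat}.
Context (C : set 'rV[R]_n) (M q : R).
Context (CM : forall x i, C x -> `|x ord0 i| <= M) (q0 : 0 < q).

Let B := Num.truncn (q * (M + M)).

Definition met_cells : {set {ffun 'I_n -> 'I_B.+1}} :=
  [set v | `[< exists2 p, C p & cell q M B p = v >]].

Lemma mem_met_cells p : C p -> cell q M B p \in met_cells.
Proof. by move=> Cp; rewrite inE; apply/asboolP; exists p. Qed.

Lemma met_cellP p i : C p ->
  (cell q M B p i)%:R <= q * (p ord0 i + M) < (cell q M B p i)%:R + 1.
Proof. by move=> Cp; apply/cellP/cell_scale; [exact: ltW|exact: CM]. Qed.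

(** The closed cells met by [C] cover it. The infinite sequence of boxes is completed by single
    points, whose volume [0 ^+ n] vanishes because [0 < n]. *)
Lemma lebesgue_rV_le_met_cells : (0 < n)%N ->
  (lebesgue_rV C <= (#|met_cells|%:R * q^-1 ^+ n)%:E)%E.
Proof.
move=> n0.
pose v k := nth [ffun=> ord0] (enum met_cells) k.
pose a k : 'rV[R]_n := \row_i ((v k i)%:R / q - M).
pose b k : 'rV[R]_n := \row_i (a k ord0 i + if (k < #|met_cells|)%N then q^-1 else 0).
have ba k i : b k ord0 i - a k ord0 i = if (k < #|met_cells|)%N then q^-1 else 0.
  by rewrite [b k ord0 i]mxE addrC addKr.
have vol k : \prod_(i < n) (b k ord0 i - a k ord0 i) =
    if (k < #|met_cells|)%N then q^-1 ^+ n else 0.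
  under eq_bigr do rewrite ba.
  by rewrite prodr_const card_ord; case: ifP => // _; rewrite expr0n eqn0Ngt n0.
apply: ereal_inf_lbound; exists a, b; split.
- move=> k i; rewrite -subr_ge0 ba; case: ifP => // _.
  by rewrite invr_ge0 ltW.
- move=> p Cp; have pS := mem_met_cells Cp.
  exists (index (cell q M B p) (enum met_cells)) => // i.
  have idx : (index (cell q M B p) (enum met_cells) < #|met_cells|)%N.
    by rewrite cardE index_mem mem_enum.
  have := ba (index (cell q M B p) (enum met_cells)) i; rewrite idx => /eqP.
  rewrite subr_eq => /eqP ->.
  rewrite !mxE /v nth_index ?mem_enum//.
  have /andP[h1 h2] := met_cellP i Cp.
  rewrite lerBlDr ler_pdivrMr// (mulrC _ q) h1/=.
  rewrite addrA -lerBlDr opprK -{1}[q^-1]mul1r -mulrDl ler_pdivlMr// mulrC (addrC 1).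
  exact: ltW.
- rewrite (nneseries_split 0 #|met_cells|); last first.
    by move=> k _; rewrite lee_fin vol; case: ifP => // _; rewrite exprn_ge0// invr_ge0 ltW.
  rewrite [X in (_ + X)%E]eseries0 ?adde0; last first.
    by move=> k; rewrite add0n leqNgt vol => /negbTE ->.
  rewrite add0n big_nat sumEFin; congr EFin.
  under eq_bigr => k /andP[_ kN] do rewrite vol kN.
  by rewrite -big_nat sumr_const_nat subn0 mulr_natl.
Qed.

(* Pair each [x] in [s] with each cell met by [C], and sort the pairs by the
   offset between the cell of [x] (of side [1 / a]) and the other cell (of side
   [1 / q = (1 + e) / a]). The pairs sharing an offset inject into a packing of
   [C]: dilated by [1 + e] and translated by that offset, the points [x] are
   [2 * (1 + e)]-separated and lie in the cells they are paired with, so moving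
   them within these cells to points of [C] keeps them [2]-separated. *)
Lemma size_packing_met_cells (a e : R) (L Q : nat) (s t : seq 'rV[R]_n) :
  0 < e -> 0 < a -> q = a / (1 + e) -> n%:R / q <= e ->
  a * L%:R = Q%:R -> uniq s -> packing (dilate L%:R (@unit_cube R n)) [set` s] ->
  (0 < L)%N -> pack C = (size t)%:R%:E ->
  (size s * #|met_cells| <= (Q + B).+1 ^ n * size t)%N.
Proof.
move=> e0 a0 qE nq aL us [sL sep] L0 tE.
(* The cube is closed: a coordinate equal to [L] falls in the cell of index [Q], so indices run from
   0 to [Q] inclusive. *)
have scell x i : x \in s ->
    (cell a 0 Q x i)%:R <= a * x ord0 i < (cell a 0 Q x i)%:R + 1.
  move=> /sL /dilate_unit_cubeP; rewrite ltr0n => /(_ L0 i) /andP[x0 xL].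
  have := @cellP R n a 0 Q x i; rewrite addr0; apply.
  rewrite mulr_ge0 ?(ltW a0)//=; apply: (@le_lt_trans _ _ Q%:R).
    by rewrite -aL ler_wpM2l// ltW.
  by rewrite ltr_nat.
pose pt v := xget 0 [set p | C p /\ cell q M B p = v].
have ptP v : v \in met_cells -> C (pt v) /\ cell q M B (pt v) = v.
  rewrite inE => /asboolP[p Cp pv].
  by apply: (@xgetPex _ 0 [set p | C p /\ cell q M B p = v]); exists p.
pose prs := [seq (x, v) | x <- s, v <- enum met_cells].
have prsP u : u \in prs -> u.1 \in s /\ u.2 \in met_cells.
  by move=> /allpairsP[[x v] [/= xs]]; rewrite mem_enum => vS ->.
(* The offset is raised by [B] to make it a natural number; since [u.2 i <= B], the subtraction is
   exact. *)
pose F (u : 'rV[R]_n * {ffun 'I_n -> 'I_B.+1}) : {ffun 'I_n -> 'I_(Q + B).+1} :=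
  [ffun i => inord (cell a 0 Q u.1 i + (B - u.2 i))].
have FE u i : F u i = (cell a 0 Q u.1 i + (B - u.2 i))%N :> nat.
  by rewrite ffunE inordK// ltnS leq_add ?leq_subr// -ltnS.
have fiber z : (size [seq u <- prs | F u == z] <= size t)%N.
  rewrite -(ler_nat R) -lee_fin -tE.
  apply: (pack_size_le (f := fun u => pt u.2)).
  - apply/filter_uniq/allpairs_uniq => //; first exact: enum_uniq.
    by move=> [? ?] [? ?].
  - by move=> u; rewrite mem_filter => /andP[_ /prsP[_ /ptP[]]].
  move=> [x v] [y w]; rewrite !mem_filter.
  move=> /andP[/eqP Fx /prsP[/= xs vS]] /andP[/eqP Fy /prsP[/= ys wS]] xvyw.
  have [[Cv cv] [Cw cw]] := (ptP v vS, ptP w wS).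
  have shift i : (cell a 0 Q x i)%:R - (v i)%:R = (cell a 0 Q y i)%:R - (w i)%:R :> R.
    have := FE (x, v) i; have := FE (y, w) i; rewrite Fx Fy/= => -> /eqP.
    have vB : (v i <= B)%N by rewrite -ltnS.
    have wB : (w i <= B)%N by rewrite -ltnS.
    by rewrite -(eqr_nat R) !natrD !natrB// => /eqP; lra.
  (* With equal offsets, [x = y] would force [v = w], so distinct pairs in a fiber have distinct
     first components. *)
  have xy : x != y.
    apply: contra xvyw => /eqP xy; rewrite xy; apply/eqP; congr (_, _).
    apply/ffunP => i; apply/val_inj/eqP; rewrite -(eqr_nat R).
    by have := shift i; rewrite xy => ?; apply/eqP; lra.
  (* This moves cell [v], numbered from the corner [-M], onto the cell of [x] dilated by [1 + e]. It
     is the same vector for every pair in the fiber. *)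
  pose o : 'rV[R]_n := \row_i (((cell a 0 Q x i)%:R - (v i)%:R) / q + M).
  have e1 : 0 < 1 + e by rewrite addr_gt0.
  have near x' v' : x' \in s -> C (pt v') -> cell q M B (pt v') = v' ->
      (forall i, (cell a 0 Q x' i)%:R - (v' i)%:R =
                 (cell a 0 Q x i)%:R - (v i)%:R :> R) ->
      dist ((1 + e) *: x') (pt v' + o) <= e.
    move=> x's Cv' cv' x'v'; apply: le_trans nq.
    apply: dist_le_coord => [|i]; first by rewrite invr_ge0 ltW.
    have := met_cellP i Cv'; rewrite cv' !mxE -x'v'.
    have := scell x' i x's.
    have -> : a = q * (1 + e) by rewrite qE divfK// gt_eqF.
    set c' := (cell _ _ _ _ _)%:R => h1 h2.
    rewrite -[leRHS]mul1r ler_pdivlMr// -[X in _ * X <= _]gtr0_norm// -normrM.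
    rewrite ler_norml.
    have -> : ((1 + e) * x' ord0 i -
        (pt v' ord0 i + ((c' - (v' i)%:R) / q + M))) * q =
        q * (1 + e) * x' ord0 i - c' + (v' i)%:R - q * (pt v' ord0 i + M).
      by field; rewrite gt_eqF.
    by apply/andP; split; lra.
  have := near x v xs Cv cv (fun=> erefl).
  have := near y w ys Cw cw (fun i => esym (shift i)).
  have := sep _ _ xs ys (elimN eqP xy).
  rewrite -(dist_addr o (pt v)).
  have := distZ x y (ltW e1).
  have := dist_triangle (pt v + o) ((1 + e) *: x) ((1 + e) *: y).
  have := dist_triangle (pt w + o) (pt v + o) ((1 + e) *: y).
  rewrite (distC (pt w + o) ((1 + e) *: y)); nra.
have -> : (size s * #|met_cells|)%N = size prs by rewrite size_allpairs cardE.
rewrite (size_partition F); apply: (leq_trans (leq_sum _ (fun z _ => fiber z))).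
by rewrite sum_nat_const card_ffun !card_ord.
Qed.

End Grid.

Lemma euclidean_bound_pack : euclidean_bound (@pack R).
Proof.
move=> n n0 C [bC _].
have [M M0 CM] := iffLR (coord_boundedP C) bC.
have [t [_ _ tE]] := pack_attained bC.
have p2 l : 0 < 2 ^+ l :> R by rewrite exprn_gt0.
have /andP[d0 _] := delta_pack_le n 0.
have dle k : exists s, [/\ uniq s, packing (dilate (2 ^+ k) (@unit_cube R n)) [set` s] &
    (delta (@pack R) n <= ((size s)%:R / 2 ^+ (k * n))%:E)%E].
  have [s [us Cs sE]] := pack_attained (@bounded_dilate_unit_cube n _ (p2 k)).
  by exists s; split => //; have /andP[_] := delta_pack_le n k; rewrite sE.
have [r rE] : exists r : R, delta (@pack R) n = r%:E.
  have [s [_ _]] := dle 0%N.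
  by move: d0; case: (delta _ _) => [r _ _|//|//]; exists r.
rewrite rE lee_fin in d0.
rewrite rE tE.
(* From this index on, [e = 2 * n / 2 ^ j] is at most 1, whence
   [n / q = n * (1 + e) / 2 ^ j <= e]. *)
pose J := (2 * n)%N.
have HJ j : (J <= j)%N -> 2 * n%:R <= 2 ^+ j :> R.
  move=> nj; rewrite -natrM -natrX ler_nat.
  by apply: leq_trans nj (ltnW (ltn_expl j _)).
suff key j : (J <= j)%N ->
    (r%:E * lebesgue_rV C <= ((1 + 2 * n%:R / 2 ^+ j) ^+ n * (size t)%:R)%:E)%E.
  (* The value [+oo] is excluded by the finite bound [key] at [j = J]. *)
  move: key; case: (_ * _)%E => [l key|key|_]; last by rewrite leNye.
    rewrite lee_fin; apply: (@le_of_le_expr_lim _ (2 * n%:R) _ n J) => j Jj.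
    by rewrite -lee_fin; exact: key.
  by have := key _ (leqnn J).
move=> Jj; set e := 2 * n%:R / 2 ^+ j.
have e0 : 0 < e by rewrite divr_gt0// mulr_gt0// ltr0n.
have e1 : 0 < 1 + e by rewrite addr_gt0.
have elt1 : e <= 1 by rewrite ler_pdivrMr// mul1r HJ.
pose q := 2 ^+ j / (1 + e).
have q0 : 0 < q by rewrite divr_gt0.
have nq : n%:R / q <= e.
  rewrite /q invf_div mulrA ler_pdivrMr//.
  have -> : e * 2 ^+ j = n%:R * 2 by rewrite divfK ?gt_eqF// mulrC.
  by rewrite ler_wpM2l//; lra.
apply: (@le_trans _ _ (r%:E * (#|met_cells C M q|%:R * q^-1 ^+ n)%:E)%E).
  by apply: lee_wpmul2l => //; exact: lebesgue_rV_le_met_cells.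
rewrite -EFinM lee_fin.
(* The cell volume is [(1 + e) ^ n / 2 ^ (j * n)]; its numerator cancels against the factor on the
   right. *)
rewrite /q invf_div expr_div_n mulrCA mulrA mulrCA.
rewrite -/q ler_wpM2l ?exprn_ge0 ?(ltW e1)//.
set N := #|met_cells C M q|; set B := Num.truncn (q * (M + M)).
(* There are [2 ^ (k + j) + B + 1] possible offsets per axis; divided by [2 ^ (k + j)], this is 1
   plus a term vanishing as [k] grows. *)
apply: (@le_of_le_expr_lim _ (B.+1%:R / 2 ^+ j) _ n 0) => k _.
have [s [us Cs]] := dle k; rewrite rE lee_fin => rs.
have cnt : (size s * N <= (2 ^ (k + j) + B).+1 ^ n * size t)%N.
  apply: (@size_packing_met_cells n C M q CM q0 (2 ^+ j) e (2 ^ k)) => //.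
  - by rewrite !natrX -exprD addnC.
  - by rewrite natrX.
  - by rewrite expn_gt0.
have -> : 1 + B.+1%:R / 2 ^+ j / 2 ^+ k = (2 ^ (k + j) + B).+1%:R / 2 ^+ (k + j) :> R.
  rewrite -addnS natrD natrX mulrDl divff ?gt_eqF// -mulrA -invfM.
  by rewrite -exprD addnC.
rewrite expr_div_n [leRHS]mulrAC ler_pdivlMr ?exprn_gt0//.
apply: (@le_trans _ _ (size s * N)%:R); last by rewrite -natrX -natrM ler_nat.
rewrite addnC exprD exprMn mulrA divfK ?gt_eqF ?exprn_gt0//.
rewrite -exprM natrM (mulrC N%:R) mulrAC ler_wpM2r//.
by rewrite -ler_pdivlMr.
Qed.

End EuclideanBound.

Theorem proposition2p9 (R : realType) :
  packing_bound_function (@pack R) /\ euclidean_bound (@pack R).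
Proof.
split; [exact: packing_bound_function_pack|exact: euclidean_bound_pack].
Qed.
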